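(* Let $X$ and $Y$ be two Banach spaces and $M>1$. Assume that $f:X\to Y$ and $g:Y\to X$ are continuous with $Lip_\infty(f)=1$, $Lip_\infty(g)<M$, and that there exists a constant $C\ge 0$ such that $$\forall x\in X\ \ \|(g\circ f)(x)-x\|\le C\quad\text{and}\quad \forall y\in Y\ \ \|(f\circ g)(y)-y\|\le C.$$ Assume also that $f$ attains its norm $\|f\|_{CL}=Lip_\infty(f)=1$ in the direction $y\in S_Y$. Then $$\forall t\in (0,1]\qquad \overline{\rho}_{Y}\Big(y,\frac{t}{576M^3}\Big)\le \overline{\rho}_X(t).$$
   Context: For a map $f:M\to N$ from an unbounded metric space $(M,d)$ to a metric space $(N,\delta)$, set $Lip_s(f)=\sup\{\delta(f(x),f(x'))/d(x,x') : d(x,x')\ge s\}$ for $s>0$ and $Lip_\infty(f)=\inf_{s>0}Lip_s(f)$; $f$ is coarse Lipschitz if $Lip_\infty(f)<\infty$. The quantity $Lip_\infty(f)$ is also denoted $\|f\|_{CL}$ when the target is a Banach space. $S_Z$ denotes the unit sphere of a Banach space $Z$. A coarse Lipschitz map $f:M\to Y$ ($M$ an unbounded metric space, $Y$ a Banach space) attains its norm in the direction $y\in S_Y$ if there is a sequence of pairs of distinct points $(s_n,t_n)$ in $M$ such that $d(s_n,t_n)\to+\infty$ and $\frac{f(t_n)-f(s_n)}{d(s_n,t_n)}\to y\,Lip_\infty(f)$ in norm. For a Banach space $(Z,\|\ \|)$, $t>0$ and $z\in S_Z$: $\overline{\rho}_Z(z,t)=\inf_{W}\sup_{w\in S_W}(\|z+tw\|-1)$,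 where $W$ runs through all closed subspaces of $Z$ of finite codimension, and $\overline{\rho}_Z(t)=\sup_{z\in S_Z}\overline{\rho}_Z(z,t)$. *)

(* Defs.v *)
From HB Require Import structures.
From mathcomp Require Import all_boot all_order all_algebra.
From mathcomp Require Import all_classical all_reals all_analysis.

Set Implicit Arguments.
Unset Strict Implicit.
Unset Printing Implicit Defensive.

Import Order.TTheory GRing.Theory Num.Theory.
Import numFieldNormedType.Exports.

Local Open Scope classical_set_scope.
Local Open Scope ring_scope.
Local Open Scope ereal_scope.

Definition unit_sphere (R : realType) (Z : normedModType R) : set Z :=
  [set z | `|z|%R = 1%R].
Arguments unit_sphere {R} Z _.

(* Normed spaces are metric spaces for the distance `|x - x'|. Suprema and
   infima are taken in \bar R, so that they always exist. *)
Definition Lip_at (R : realType) (V W : normedModType R) (s : R)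
    (f : V -> W) : \bar R :=
  ereal_sup [set ((`|f p.1 - f p.2| / `|p.1 - p.2|)%R)%:E
            | p in [set p : V * V | (s <= `|p.1 - p.2|)%R]].

Definition Lip_infty (R : realType) (V W : normedModType R)
    (f : V -> W) : \bar R :=
  ereal_inf [set Lip_at s f | s in [set s : R | (0 < s)%R]].

Definition coarse_lipschitz (R : realType) (V W : normedModType R)
    (f : V -> W) : Prop := Lip_infty f < +oo.

Definition attains_norm (R : realType) (V W : normedModType R)
    (f : V -> W) (y : W) : Prop :=
  coarse_lipschitz f /\
  exists s t : nat -> V,
    [/\ forall n, s n <> t n,
        (`|s n - t n|)%R @[n --> \oo] --> +oo%R &
        (`|s n - t n|^-1 *: (f (t n) - f (s n)))%R @[n --> \oo]
          --> (fine (Lip_infty f) *: y)%R].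

(* The codimension is finite when finitely many vectors span Z modulo W. *)
Definition finite_codim (R : realType) (Z : normedModType R)
    (W : set Z) : Prop :=
  exists (n : nat) (e : 'I_n -> Z), forall z : Z,
    exists a : 'I_n -> R, W (z - \sum_(i < n) a i *: e i)%R.

Definition closed_finite_codim_subspace (R : realType) (Z : normedModType R)
    (W : set Z) : Prop :=
  [/\ GRing.submod_closed [in W], closed W & finite_codim W].

(* If Z is finite-dimensional, W ranges over a family containing {0}, whose
   unit sphere is empty; with ereal_sup set0 = -oo, both moduli are then -oo. *)
Definition rho_bar_at (R : realType) (Z : normedModType R) (z : Z) (t : R)
    : \bar R :=
  ereal_inf [set ereal_sup [set (`|z + t *: w| - 1)%:E
                           | w in W `&` unit_sphere Z]
            | W in @closed_finite_codim_subspace R Z].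

Definition rho_bar (R : realType) (Z : normedModType R) (t : R) : \bar R :=
  ereal_sup [set rho_bar_at z t | z in unit_sphere Z].
Arguments rho_bar {R} Z t.

(* Main.v *)
Require Import Defs.
From HB Require Import structures.
From mathcomp Require Import all_boot all_order all_algebra.
From mathcomp Require Import zify ring lra.

(** Let [s], [t] in [X] be at a large distance [L], with [f t - f s] close to
    [L *: y], and let [z = (t - s) / L]. Choose [W] of finite codimension in
    [X] such that [`|z + theta *: w| <= 1 + r] on the unit sphere of [W], with
    [r] slightly above [rho_bar X theta]. The vectors [m + w], where [m] is the
    midpoint of [s] and [t] and [w] runs through the ball of [W] of radius
    [(L / 2) * theta], are approximate midpoints of [s] and [t]. Since [f] is
    almost 1-Lipschitz at large distances, their images [f (m + w)] are
    approximate midpoints of [f s] and [f t], that is of points differing by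
    almost [L *: y].

    The Gorelik principle ([gorelik_principle]) says that these images,
    translated by finitely many vectors [k], come within a constant of every
    point of a ball whose radius is of order [L * theta / M]. Let [V] be the
    common kernel of finitely many functionals of norm at most one that norm the
    vectors [(L / 2) *: y + k] and [(L / 2) *: y - k], with the [k] suitably
    centred. If [u] in [V] is close to the sum of some [k] and some [p] coming
    from an approximate midpoint, then moving along [V] does not decrease the
    norms in question, so [k] obeys the same bounds as [p] does, and averaging
    bounds [(L / 2) *: y + u / 2] ([two_sided_bound], [transfer_subspace]). After
    division by [L / 2] and for [L] large this is the required bound on
    [`|y + tau *: v|] for [v] in the sphere of [V], with
    [tau = theta / (16 * M)]; smaller values of [tau] follow by convexity.

    The topological content of the Gorelik principle is a fixed point theorem in
    the finite-dimensional space [X / W]. As bounded errors are harmless at the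
    scale [L], a discrete version is enough ([approximate_zero]): it follows from
    Scarf's combinatorial lemma ([complete_cell]) on a fine grid of a simplex
    mapped onto the convex hull of a finite net of a ball modulo [W]. In this
    form only the bounds [K * `|x - x'| + C] on [f] and [g] enter. *)

Set Implicit Arguments.
Unset Strict Implicit.
Unset Printing Implicit Defensive.

(** * Scarf's combinatorial lemma *)

(** [P] carries one linear order per index [i : I] (the rank [r i]), and each
    index has a slack element, lowest in its own order and above every non-slack
    element in the other orders. A set is dominant when no element of [P] is
    strictly above it in every order.

    Dominant sets with [#|I|] elements are the cells of a pseudomanifold whose
    walls are the dominant sets with one element less: a wall that contains a
    non-slack element lies in exactly two cells. As in Sperner's lemma,
    a parity argument counts in two ways the flags, which are the pairs of a
    cell and one of its walls that carries all labels but [i0]. *)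
Section Scarf.
Variables (I P : finType) (r : I -> P -> nat) (slack : I -> P) (c : P -> I).
Hypothesis r_inj : forall i, injective (r i).
Hypothesis slack_min : forall i p, r i (slack i) <= r i p.
Hypothesis slack_gt : forall i j p,
  j != i -> p \notin codom slack -> r i p < r i (slack j).
Hypothesis c_slack : cancel slack c.
Variable i0 : I.

Definition dominant (S : {set P}) :=
  [forall y, exists i, forall x in S, r i y <= r i x].

Definition cell (S : {set P}) := (#|S| == #|I|) && dominant S.

Lemma dominantP (S : {set P}) :
  reflect (forall y, exists i, forall x, x \in S -> r i y <= r i x)
          (dominant S).
Proof.
apply: (iffP forallP) => H y.
  by have /existsP[i /forall_inP Hi] := H y; exists i.
by have [i Hi] := H y; apply/existsP; exists i; apply/forall_inP.
Qed.

Lemma dominantS (A B : {set P}) : A \subset B -> dominant B -> dominant A.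
Proof.
move=> sAB /dominantP dB; apply/dominantP => y.
by have [i Hi] := dB y; exists i => x xA; apply: Hi; apply: (subsetP sAB).
Qed.

Let J := [set~ i0].

Lemma cardJ : #|I| = #|J|.+1.
Proof. by rewrite cardsC1 prednK //; apply/card_gt0P; exists i0. Qed.

(** Labels take all values but [i0] on [S :\ x]. If [i0] is not the label of
    [x], then [x] has the label of exactly one other element [x'], and
    exchanging [x] and [x'] gives the only other wall with the same labels. *)
Lemma flags_of_cell (S : {set P}) : cell S -> c @: S != [set: I] ->
  ~~ odd #|[set x in S | c @: (S :\ x) == J]|.
Proof.
case/andP => /eqP cardS domS notfull.
set F := [set x in S | _].
have [->|[x]] := set_0Vmem F; first by rewrite cards0.
rewrite inE => /andP[xS /eqP cx].
have cardx : #|S :\ x| = #|J|.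
  by apply/eqP; rewrite -eqSS -cardJ -cardS (cardsD1 x S) xS.
have injx : {in S :\ x &, injective c}.
  by apply/imset_injP; rewrite cx cardx.
have cxJ : c x \in J.
  rewrite !inE; apply: contra notfull => /eqP cxi0.
  rewrite -(setD1K xS) imsetU imset_set1 cx cxi0.
  by apply/eqP/setP => i; rewrite !inE orbN.
have := cxJ; rewrite -cx => /imsetP[x' x'Sx cxx'].
have [x'x x'S] : x' != x /\ x' \in S by move: x'Sx; rewrite !inE => /andP[].
suff -> : F = [set x; x'] by rewrite cards2 eq_sym x'x.
apply/setP => z; rewrite !inE; apply/andP/orP => [[zS /eqP cz]|].
  have [->|zx] := eqVneq z x; first by left.
  have zSx : z \in S :\ x by rewrite !inE zx.
  have : c z \in c @: (S :\ z) by rewrite cz -cx imset_f.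
  move=> /imsetP[w]; rewrite !inE => /andP[wz wS] czw.
  have [wx|wx] := eqVneq w x.
    right; apply/eqP; apply: injx => //; by rewrite czw wx.
  case/eqP: wz; apply: injx => //; first by rewrite !inE wx.
case=> /eqP ->; first by rewrite xS cx.
split=> //; rewrite -cx; apply/eqP/setP => i; apply/imsetP/imsetP => -[w].
  rewrite !inE => /andP[wx' wS] ->.
  have [->|wx] := eqVneq w x; first by exists x'.
  by exists w => //; rewrite !inE wx.
rewrite !inE => /andP[wx wS] ->.
have [->|wx'] := eqVneq w x'; last by exists w => //; rewrite !inE wx'.
by exists x => //; rewrite !inE eq_sym x'x.
Qed.

(** The boundary of the pseudomanifold, seen from [i0]: the wall of all slacks
    but [i0] can only be completed by the highest non-slack element for [i0]. *)
Lemma special_door (p0 : P) : p0 \notin codom slack ->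
  #|[set x | (x \notin slack @: J) && cell (x |: slack @: J)]| = 1.
Proof.
move=> p0T.
pose T := [pred p | p \notin codom slack].
pose x0 := [arg max_(x > p0 in T) r i0 x].
have [x0T x0max] : x0 \in T /\ forall p, p \in T -> r i0 p <= r i0 x0.
  by rewrite /x0; case: arg_maxnP.
have slack_inj : injective slack by apply: can_inj c_slack.
apply/eqP/cards1P; exists x0; apply/setP => x; rewrite !inE.
have TnJ p : p \in T -> p \notin slack @: J.
  by apply: contra => /imsetP[j _ ->]; apply: codom_f.
apply/andP/eqP => [[xJ /andP[_ /dominantP dx]]|->].
  have Tlow y : y \in T -> r i0 y <= r i0 x.
    move=> yT; have [i Hi] := dx y.
    have [<-|ii0] := eqVneq i i0; first by apply: Hi; rewrite !inE eqxx.
    have := Hi (slack i); rewrite !inE imset_f ?orbT ?inE// => /(_ isT).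
    have := slack_min i y => le1 le2.
    have /r_inj yE : r i y = r i (slack i) by apply/eqP; rewrite eqn_leq le1 le2.
    by move: yT; rewrite yE inE codom_f.
  have xT : x \in T.
    rewrite inE; apply/negP => /codomP[i xi].
    have ii0 : i = i0.
      by apply/eqP; apply: contraNT xJ => ii0; rewrite xi imset_f // !inE.
    have := Tlow _ p0T; have := slack_min i0 p0; rewrite xi ii0 => le1 le2.
    have /r_inj yE : r i0 p0 = r i0 (slack i0) by apply/eqP; rewrite eqn_leq le1 le2.
    by move: p0T; rewrite yE codom_f.
  by apply: (@r_inj i0); apply/eqP; rewrite eqn_leq x0max //= Tlow.
split; first exact: TnJ.
apply/andP; split; first by rewrite cardsU1 TnJ // card_imset // cardJ.
apply/dominantP => y; have [yT|] := boolP (y \in T).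
  exists i0 => x'; rewrite !inE => /orP[/eqP->|]; first exact: x0max.
  move=> /imsetP[j]; rewrite !inE => ji0 ->; apply: ltnW; exact: slack_gt.
by rewrite inE negbK => /codomP[i ->]; exists i.
Qed.

(** Let [m i] be the lowest element of [tau] for [i]. Dominance makes [m] onto
    [tau], and [#|tau| = #|I| - 1], so [m] identifies exactly one pair of
    indices [a], [b]. An element that completes [tau] to a cell must become the
    lowest one for [a] or for [b] and stay above [m j] for every other [j]:
    it is the highest element for [a] among those above [m j] for all
    [j != a], or the same with [b]. Both exist because the slacks of [a] and
    [b] are candidates, and they differ because [tau] is dominant. *)
Lemma regular_door (tau : {set P}) (p0 : P) : p0 \notin codom slack ->
  p0 \in tau -> #|tau| = #|J| -> dominant tau ->
  #|[set x | (x \notin tau) && cell (x |: tau)]| = 2.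
Proof.
move=> p0T p0tau cardtau /dominantP domt.
pose m i := [arg min_(x < p0 in tau) r i x].
have mtau i : m i \in tau by rewrite /m; case: arg_minnP.
have mmin i x : x \in tau -> r i (m i) <= r i x.
  by rewrite /m; case: arg_minnP => // y _ H; apply: H.
have own x : x \in tau -> exists i, m i = x.
  move=> xt; have [i Hi] := domt x; exists i.
  by apply: (@r_inj i); apply/eqP; rewrite eqn_leq mmin //= Hi.
have [a [b [ab mab]]] : exists a b, a != b /\ m a = m b.
  have : ~~ [forall i, forall j, (m i == m j) ==> (i == j)].
    apply/negP => /forallP H.
    have /card_imset e : injective m.
      by move=> i j mij; apply/eqP; move: (H i) => /forallP/(_ j); rewrite mij eqxx.
    have : #|m @: [set: I]| <= #|tau|.
      by apply: subset_leq_card; apply/subsetP => _ /imsetP[i _ ->].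
    by rewrite e cardsT cardtau cardJ ltnn.
  rewrite negb_forall => /existsP[a]; rewrite negb_forall => /existsP[b].
  by rewrite negb_imply => /andP[/eqP ? ?]; exists a, b.
have minj d d' : d != d' -> m d = m d' ->
    forall i j, m i = m j -> i != d -> j != d -> i = j.
  move=> dd' mdd' i j mij id jd.
  have : {in [set~ d] &, injective m}.
    apply/imset_injP; rewrite cardsC1 cardJ /= -cardtau; apply/eqP/eq_card => x.
    apply/imsetP/idP => [[k _ ->]//|/own[k <-]].
    have [->|kd] := eqVneq k d; last by exists k => //; rewrite !inE.
    by exists d' => //; rewrite !inE eq_sym.
  by apply => //; rewrite !inE.
have ontoab i j : i != j -> m i = m j -> i \in [:: a; b].
  move=> ij mij; rewrite !inE; apply: contraNT ij; rewrite negb_or => /andP[ia ib].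
  have [ja|ja] := eqVneq j a; last by rewrite (minj _ _ ab mab _ _ mij ia ja).
  have ba : b != a by rewrite eq_sym.
  have jb : j != b by rewrite ja.
  by rewrite (minj _ _ ba (esym mab) _ _ mij ib jb).
(* Candidates for becoming the lowest element for i. *)
pose M i := [set x | [forall j, (j != i) ==> (r j (m j) < r j x)]].
have MP i x : reflect (forall j, j != i -> r j (m j) < r j x) (x \in M i).
  rewrite inE; apply: (iffP forallP) => H j; last by apply/implyP; apply: H.
  by move=> ji; move: (H j) => /implyP; apply.
pose top i := [set x in M i | [forall y in M i, r i y <= r i x]].
have topP i x : reflect (x \in M i /\ forall y, y \in M i -> r i y <= r i x) (x \in top i).
  rewrite [x \in top i]inE; apply: (iffP andP) => -[xM H]; split => //; first exact/forall_inP.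
  by apply/forall_inP.
have cardtop i : #|top i| = 1.
  have sM : slack i \in M i.
    apply/MP => j ji; apply: leq_ltn_trans (mmin j p0 p0tau) _.
    by apply: slack_gt => //; rewrite eq_sym.
  pose x0 := [arg max_(x > slack i in M i) r i x].
  have [x0M x0max] : x0 \in M i /\ forall p, p \in M i -> r i p <= r i x0.
    by rewrite /x0; case: arg_maxnP.
  apply/eqP/cards1P; exists x0; apply/setP => x; apply/topP/set1P => [[xM H]|->//].
  by apply: (@r_inj i); apply/eqP; rewrite eqn_leq x0max //= H.
have Mlow i x : x \in M i -> r i x <= r i (m i).
  move=> /MP xM; have [j Hj] := domt x.
  have [<-|ji] := eqVneq j i; first exact: Hj.
  by have := xM j ji; rewrite ltnNge Hj.
have MnT d d' x : d != d' -> m d = m d' -> x \in M d -> x \notin tau.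
  move=> dd' mdd' /MP xM; apply/negP => /own[j mj].
  have [jd|jd] := eqVneq j d; last by have := xM j jd; rewrite mj ltnn.
  by have := xM d'; rewrite eq_sym => /(_ dd'); rewrite -mdd' -jd mj ltnn.
have topcell d d' x : d != d' -> m d = m d' -> x \in top d ->
    (x \notin tau) && cell (x |: tau).
  move=> dd' mdd' /topP[xM xtop]; have xt := MnT _ _ _ dd' mdd' xM.
  rewrite xt /cell cardsU1 xt cardtau cardJ eqxx /=.
  apply/dominantP => y; have [yM|/MP yM] := boolP (y \in M d).
    exists d => x'; rewrite !inE => /orP[/eqP->|x't]; first exact: xtop.
    apply: leq_trans (xtop _ yM) _; apply: leq_trans (Mlow _ _ xM) _; exact: mmin.
  have [j jd ymj] : exists2 j, j != d & r j y <= r j (m j).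
    have /existsP[j] : [exists j, (j != d) && (r j y <= r j (m j))].
      apply: contra_notT yM; rewrite negb_exists => /forallP H j jd.
      by move: (H j); rewrite jd /= -ltnNge.
    by move=> /andP[]; exists j.
  exists j => x'; rewrite !inE => /orP[/eqP->|x't].
    apply: leq_trans ymj _; apply: ltnW; by move/MP: xM; apply.
  exact: leq_trans (mmin _ _ x't).
have -> : [set x | (x \notin tau) && cell (x |: tau)] = top a :|: top b.
  apply/setP => x; rewrite inE [RHS]inE; apply/idP/idP; last first.
    by case/orP; [exact: topcell ab mab|apply: (topcell b a) => //; rewrite eq_sym].
  move=> /andP[xt /andP[_ /dominantP dx]].
  have xnm i : r i x != r i (m i).
    by apply: contraNneq xt => /r_inj ->.
  have low i : r i x < r i (m i) -> exists j,
      [/\ j != i, m j = m i & r j (m j) < r j x].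
    move=> xi; have [j Hj] := dx (m i).
    have jx : r j (m i) <= r j x by apply: Hj; rewrite !inE eqxx.
    have mj : m j = m i.
      apply: (@r_inj j); apply/eqP; rewrite eqn_leq mmin //=.
      by apply: Hj; rewrite !inE mtau orbT.
    have ji : j != i by apply: contraTneq jx => ->; rewrite -ltnNge.
    by exists j; split => //; rewrite mj ltn_neqAle jx -mj eq_sym xnm.
  have [i Hi] := dx x.
  have xi : r i x < r i (m i).
    by rewrite ltn_neqAle xnm Hi // !inE mtau orbT.
  have uni k : r k x < r k (m k) -> k = i.
    move=> xk; apply/eqP; apply: contraTT isT => ki.
    have [j [ji mji xj]] := low i xi; have [l [lk mlk xl]] := low k xk.
    have := ontoab j i ji mji; have := ontoab l k lk mlk.
    have := ontoab i j; rewrite eq_sym ji mji => /(_ isT erefl).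
    have := ontoab k l; rewrite eq_sym lk mlk => /(_ isT erefl).
    have jk : j != k by apply: contraTneq xj => ->; rewrite -leqNgt ltnW.
    have li : l != i by apply: contraTneq xl => ->; rewrite -leqNgt ltnW.
    by rewrite !inE => /orP[] /eqP E1 /orP[] /eqP E2 /orP[] /eqP E3 /orP[] /eqP E4;
      move: ji lk jk li ki; rewrite ?E1 ?E2 ?E3 ?E4 ?eqxx.
  have itop : x \in top i.
    have xM k : k != i -> r k (m k) < r k x.
      by move=> ki; rewrite ltn_neqAle eq_sym xnm /= leqNgt; apply: contra ki => /uni/eqP.
    apply/topP; split; first exact/MP.
    move=> y /MP yM; have [j Hj] := dx y.
    have [<-|ji] := eqVneq j i; first by apply: Hj; rewrite !inE eqxx.
    have := yM j ji; rewrite ltnNge Hj // !inE mtau orbT //.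
  have [j [ji mji xj]] := low i xi.
  have /orP[/eqP E|/eqP E] : (i == a) || (i == b).
    by have := ontoab i j; rewrite eq_sym ji mji => /(_ isT erefl); rewrite !inE.
  1,2: by move: itop; rewrite E => ->; rewrite ?orbT.
rewrite cardsU !cardtop; suff -> : top a :&: top b = set0 by rewrite cards0.
apply/setP => x; rewrite !inE; apply/negP => /andP[/andP[/forallP xa _] /andP[/forallP xb _]].
have [j Hj] := domt x; have [ja|ja] := eqVneq j a.
  have := xb j; rewrite ja ab /= ltnNge -ja Hj //.
by have := xa j; rewrite ja /= ltnNge Hj.
Qed.

Lemma odd_sum (T : finType) (F : T -> nat) :
  (forall x, ~~ odd (F x)) -> ~~ odd (\sum_x F x).
Proof. by move=> H; elim/big_ind: _ => // x y; rewrite oddD => /negPf-> /negPf->. Qed.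

(** Were no cell completely labelled, the number of flags would be even cell
    by cell, whereas counted wall by wall it is odd, since the slack wall
    contributes one and every other wall none or two. *)
Lemma complete_cell (p0 : P) : p0 \notin codom slack ->
  exists2 S : {set P}, dominant S & c @: S = [set: I].
Proof.
move=> p0T.
have [/existsP[S /andP[dS /eqP cS]]|] :=
    boolP [exists S : {set P}, dominant S && (c @: S == [set: I])].
  by exists S.
rewrite negb_exists => /forallP none; exfalso.
pose flag S x := [&& cell S, x \in S & c @: (S :\ x) == J].
have E1 : ~~ odd (\sum_x \sum_(S : {set P}) flag S x).
  rewrite exchange_big; apply: odd_sum => S /=.
  have [cS|ncS] := boolP (cell S); last first.
    by rewrite big1 // => x _; rewrite /flag (negPf ncS).
  have -> : \sum_x flag S x = #|[set x in S | c @: (S :\ x) == J]|.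
    rewrite -sum1_card [RHS]big_mkcond /=; apply: eq_bigr => x _.
    by rewrite /flag cS [x \in [set _ in _ | _]]inE.
  apply: flags_of_cell => //; have := none S; rewrite negb_and.
  by case/andP: cS => _ -> /=.
pose door (tau : {set P}) x := [&& c @: tau == J, x \notin tau & cell (x |: tau)].
have E2 : \sum_x \sum_S flag S x = \sum_tau \sum_x door tau x.
  rewrite [RHS]exchange_big; apply: eq_bigr => x _ /=.
  rewrite (bigID (fun S : {set P} => x \in S)) /= [X in _ + X]big1 ?addn0; last first.
    by move=> S /negPf xS; rewrite /flag xS andbF.
  rewrite [RHS](bigID (fun S : {set P} => x \in S)) /= [X in _ = X + _]big1 ?add0n; last first.
    by move=> S xS; rewrite /door xS andbF.
  (* A flag (S, x) corresponds to the wall S :\ x together with x. *)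
  rewrite (reindex_onto (fun S => x |: S) (fun S => S :\ x)) /=; last first.
    by move=> S; apply: setD1K.
  apply: eq_big => [S|S /andP[xS /eqP SE]]; last first.
    have xnS : x \notin S by rewrite -SE !inE eqxx.
    by rewrite /flag /door xS xnS SE /= andbC.
  rewrite !inE eqxx /=; apply/eqP/idP => [<-|]; first by rewrite !inE eqxx.
  exact: setU1K.
have E3 : odd (\sum_tau \sum_x door tau x).
  rewrite (bigD1 (slack @: J)) //=.
  have -> : \sum_x door (slack @: J) x = 1.
    rewrite -(special_door p0T) -sum1_card [RHS]big_mkcond /=; apply: eq_bigr => x _.
    rewrite /door inE -imset_comp.
    rewrite (eq_imset (g := id)) ?imset_id ?eqxx /=; last by move=> i /=; rewrite c_slack.
    by [].
  rewrite oddD /=; rewrite big_mkcond; apply: odd_sum => tau.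
  case: ifP => // taus.
  have [ctau|nc] := boolP (c @: tau == J); last first.
    by rewrite big1 // => x _; rewrite /door (negPf nc).
  have [/existsP[x /andP[xt /andP[cardx domx]]]|nx] :=
      boolP [exists x, (x \notin tau) && cell (x |: tau)]; last first.
    rewrite big1 // => x _; rewrite /door.
    by move: nx; rewrite negb_exists => /forallP/(_ x)/negPf ->; rewrite andbF.
  have cardt : #|tau| = #|J|.
    by apply/eqP; rewrite -eqSS -cardJ -(eqP cardx) cardsU1 xt.
  have [p /andP[pt pT]] : exists p, (p \in tau) && (p \notin codom slack).
    apply/existsP; apply: contraTT taus; rewrite negb_exists negbK => /forallP H.
    have tS p : p \in tau -> p = slack (c p).
      move=> pt; have := H p; rewrite pt /= negbK => /codomP[i ->].
      by rewrite c_slack.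
    rewrite -(eqP ctau) -imset_comp; apply/eqP/setP => p.
    apply/idP/imsetP => [pt|[q qt ->]]; last by rewrite /= -tS.
    by exists p => //=; apply: tS.
  have <- : 2 = \sum_x door tau x; last by [].
  rewrite -(regular_door pT pt cardt (dominantS (subsetUr _ _) domx)).
  rewrite -sum1_card [LHS]big_mkcond /=; apply: eq_bigr => z _.
  by rewrite /door inE ctau.
by move: E1; rewrite E2 E3.
Qed.

End Scarf.

(** * Labellings of the grid of a simplex *)

(** Slacks are adjoined as the right summand of [T + I]. Ties between the
    heights [h i] are broken by the enumeration of [T], and the bound [B i]
    puts the slacks of the other indices above [T]. An index [i] that
    witnesses dominance against an element of [T] cannot have its slack in the
    set, this slack being lowest for [i]; as the set carries the label [i], one
    of its elements in [T] does. *)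
Lemma labelled_dominant_subset (I T : finType) (h : I -> T -> nat) (c : T -> I) (t0 : T) :
  exists S : {set T}, S != set0 /\
    forall y, exists2 i, i \in c @: S & forall x, x \in S -> h i y <= h i x.
Proof.
pose rT i t := (h i t * #|T| + enum_rank t).+1.
have rT_lt i t t' : h i t < h i t' -> rT i t < rT i t'.
  move=> lt_h; rewrite /rT ltnS.
  apply: leq_trans (leq_addr _ _); apply: leq_trans (leq_mul lt_h (leqnn _)).
  by rewrite mulSn addnC ltn_add2r; apply: ltn_ord.
have rT_le i t t' : rT i t <= rT i t' -> h i t <= h i t'.
  by rewrite leqNgt [_ <= h _ _]leqNgt; apply: contra => /rT_lt.
have rT_inj i : injective (rT i).
  move=> t t' E; apply: enum_rank_inj; apply: val_inj => /=.
  have : h i t = h i t' by apply/eqP; rewrite eqn_leq !rT_le // E.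
  by case: E => + hE; rewrite hE; lia.
pose B i := (\max_t rT i t).+1.
have rTB i t : rT i t < B i by rewrite ltnS; apply: leq_bigmax_cond.
pose r i (p : T + I) := match p with
  | inl t => rT i t
  | inr j => if j == i then 0 else B i + enum_rank j end.
have r_inj i : injective (r i).
  have BE (j : I) : B i + enum_rank j <> 0 by rewrite /B; lia.
  move=> [t|j] [t'|j'] /=; first by move/rT_inj => ->.
  - by case: eqP => // _ E; have := rTB i t; rewrite E; lia.
  - by case: eqP => // _ E; have := rTB i t'; rewrite -E; lia.
  have [->|_] := eqVneq j i; have [->|_] := eqVneq j' i => // E.
  by congr inr; apply: enum_rank_inj; apply: val_inj; move: E => /=; lia.
pose cP (p : T + I) := match p with inl t => c t | inr j => j end.
have r_min i p : r i (inr i) <= r i p by rewrite /= eqxx.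
have inlP p : p \notin codom (@inr T I) -> exists t, p = inl t.
  by case: p => [t|j]; [exists t | rewrite codom_f].
have r_gt i j p : j != i -> p \notin codom (@inr T I) -> r i p < r i (inr j).
  move=> /negPf ji /inlP[t ->] /=; rewrite ji; have := rTB i t; lia.
have t0P : inl t0 \notin codom (@inr T I) by apply/codomP => -[].
have [S dS cS] := complete_cell (slack := inr) (c := cP) r_inj r_min r_gt
  (fun=> erefl) (c t0) t0P.
have /dominantP domS := dS.
have dT y : exists2 i, i \in c @: [set t | inl t \in S] &
    forall x, inl x \in S -> rT i y <= rT i x.
  have [i Hi] := domS (inl y); exists i; last by move=> x /Hi.
  have : i \in cP @: S by rewrite cS inE.
  move=> /imsetP[[t|j] pS iE]; first by rewrite iE /=; apply: imset_f; rewrite inE.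
  by have := Hi _ pS; rewrite iE /= eqxx.
exists [set t | inl t \in S]; split.
  have [i /imsetP[t tS _] _] := dT t0.
  by apply/set0Pn; exists t.
by move=> y; have [i iS Hi] := dT y; exists i => // x; rewrite inE => /Hi/rT_le.
Qed.

(** Points of the standard simplex whose barycentric coordinates are
    multiples of [1 / p], multiplied by [p]. *)
Definition grid (I : finType) (p : nat) :=
  {l : {ffun I -> 'I_p.+1} | \sum_i l i == p :> nat}.

Lemma grid_sum (I : finType) p (l : grid I p) : \sum_i val l i = p.
Proof. by apply/eqP; apply: (valP l). Qed.

(** A labelling of the grid without any boundary condition admits a small set
    of grid points, within [#|I|] steps of [l0], which carries every label of a
    face containing [l0] up to [#|I|] steps. For a dominant set [S] with label
    set [C], let [m i] be the least [i]-th coordinate on [S]. The numbers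
    [(m i).+1], [i] in [C], add up to more than [p], otherwise some grid point
    would be above [S] in all directions of [C]. So each point of [S] exceeds
    [m] on [C], and [0] off [C], by less than [#|C|] steps in total. *)
Lemma simplex_grid_kkm (I : finType) (p : nat) (i1 : I) (c : grid I p -> I) :
  exists (C : {set I}) (l0 : grid I p) (l : I -> grid I p),
    [/\ forall i, i \in C -> c (l i) = i,
        forall i, i \in C -> forall j, (val (l i) j <= val l0 j + #|I|) /\
                             (val l0 j <= val (l i) j + #|I|)
      & forall i, i \notin C -> val l0 i <= #|I|].
Proof.
have mkgrid (F : I -> nat) : \sum_i F i = p ->
    exists l : grid I p, forall i, val l i = F i :> nat.
  move=> FE; pose l := [ffun i => inord (F i) : 'I_p.+1].
  have lE i : l i = F i :> nat.
    by rewrite ffunE inordK // ltnS -FE (bigD1 i) //= leq_addr.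
  have lP : \sum_i l i == p :> nat by rewrite -[X in _ == X]FE; apply/eqP/eq_bigr.
  by exists (exist _ l lP).
have [t0 _] : exists l : grid I p, forall i, val l i = (if i == i1 then p else 0) :> nat.
  by apply: mkgrid; rewrite -big_mkcond big_pred1_eq.
have [S [/set0Pn[l0 l0S] domS]] := labelled_dominant_subset (fun i (l : grid I p) => val l i : nat) c t0.
set C := c @: S in domS.
pose m i := val [arg min_(l < l0 in S) (val l i : nat)] i : nat.
have mP i l : l \in S -> m i <= val l i.
  by rewrite /m; case: arg_minnP => // l' _ H; apply: H.
have mS i : exists2 l, l \in S & m i = val l i.
  by rewrite /m; case: arg_minnP => // l' l'S _; exists l'.
have sum_m : p < \sum_(i in C) (m i).+1.
  rewrite ltnNge; apply/negP => le_p.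
  pose k := p - \sum_(i in C) (m i).+1.
  pose i2 := c l0.
  have i2C : i2 \in C by apply: imset_f.
  have [y yE] : exists l : grid I p,
      forall i, val l i = (if i \in C then (m i).+1 + (if i == i2 then k else 0) else 0) :> nat.
    apply: mkgrid; rewrite -big_mkcond big_split /= -[X in _ + X]big_mkcondr /=.
    rewrite [X in _ + X](big_pred1 i2) ?subnKC // => i /=; rewrite andbC.
    by have [->|] := eqVneq i i2; rewrite ?i2C.
  have [i iC Hi] := domS y; have [l lS mE] := mS i.
  have := Hi l lS; rewrite -mE yE iC; lia.
have small l : l \in S -> \sum_(i in C) (val l i - m i) + \sum_(i | i \notin C) val l i <= #|I|.
  move=> lS.
  have E : \sum_(i in C) val l i + \sum_(i | i \notin C) val l i = p.
    by rewrite -[RHS](grid_sum l) [RHS](bigID (mem C)).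
  have E' : \sum_(i in C) (val l i - m i) + \sum_(i in C) m i = \sum_(i in C) val l i.
    by rewrite -big_split /=; apply: eq_bigr => i iC; rewrite subnK // mP.
  have E'' : \sum_(i in C) (m i).+1 = \sum_(i in C) m i + #|C|.
    by rewrite -sum1_card -big_split; apply: eq_bigr => i _; rewrite /= addn1.
  have cC : #|C| <= #|I| by apply: max_card.
  by move: sum_m E E' E'' cC; lia.
have smallC l i : l \in S -> i \in C -> val l i <= m i + #|I|.
  by move=> lS iC; have := small l lS; rewrite (bigD1 i) //=; have := mP i l lS; lia.
have smallN l i : l \in S -> i \notin C -> val l i <= #|I|.
  by move=> lS iC; have := small l lS; rewrite addnC (bigD1 i) //=; lia.
have close l l' i : l \in S -> l' \in S -> val l i <= val l' i + #|I|.
  move=> lS l'S; have [iC|iC] := boolP (i \in C).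
    by have := smallC l i lS iC; have := mP i l' l'S; lia.
  by have := smallN l i lS iC; lia.
pose l i := odflt l0 [pick l in S | c l == i].
have lP i : i \in C -> l i \in S /\ c (l i) = i.
  move=> /imsetP[l' l'S ->]; rewrite /l; case: pickP => [l'' /andP[? /eqP ?]//|/(_ l')].
  by rewrite l'S eqxx.
exists C, l0, l; split => [i /lP[]//|i /lP[liS _] j|i]; last exact: smallN.
by split; apply: close.
Qed.

From mathcomp Require Import all_classical all_reals all_analysis.
Import Order.TTheory GRing.Theory Num.Theory.
Import numFieldNormedType.Exports.
Local Open Scope classical_set_scope.
Local Open Scope ring_scope.

(** * Linear identities between vectors *)

(** Formal linear combinations over an environment of vectors: an identity
    between vectors follows from the identities between the coefficients of
    each variable, which are left to [ring] or [field]. *)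
Inductive lexpr (R : Type) :=
  | LVar of nat | LZero | LAdd of lexpr R & lexpr R | LOpp of lexpr R
  | LScale of R & lexpr R.
Arguments LVar {R}. Arguments LZero {R}.

Section Lexpr.
Variables (R : pzRingType) (V : lmodType R).

Fixpoint leval (env : seq V) (e : lexpr R) : V := match e with
  | LVar k => nth 0 env k
  | LZero => 0
  | LAdd a b => leval env a + leval env b
  | LOpp a => - leval env a
  | LScale c a => c *: leval env a end.

Fixpoint lcoef (e : lexpr R) (i : nat) : R := match e with
  | LVar k => if Nat.eqb i k then 1 else 0
  | LZero => 0
  | LAdd a b => lcoef a i + lcoef b i
  | LOpp a => - lcoef a i
  | LScale c a => c * lcoef a i end.

Fixpoint lcoef_eq (e1 e2 : lexpr R) (n : nat) : Prop :=
  if n is n'.+1 then lcoef e1 n' = lcoef e2 n' /\ lcoef_eq e1 e2 n' else True.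

Lemma levalE env e : leval env e = \sum_(i < size env) lcoef e i *: nth 0 env i.
Proof.
elim: e => [k||a IHa b IHb|a IHa|c a IHa] /=.
- have [ks|ks] := ltnP k (size env).
    rewrite (bigD1 (Ordinal ks)) //= PeanoNat.Nat.eqb_refl scale1r.
    rewrite big1 ?addr0 // => i ik; case: PeanoNat.Nat.eqb_spec => [E|]; last by rewrite scale0r.
    by case/eqP: ik; apply: val_inj.
  rewrite nth_default // big1 // => i _; case: PeanoNat.Nat.eqb_spec => [E|]; last by rewrite scale0r.
  by have := ltn_ord i; rewrite E ltnNge ks.
- by rewrite big1 // => i _; rewrite scale0r.
- by rewrite IHa IHb -big_split; apply: eq_bigr => i _; rewrite scalerDl.
- by rewrite IHa -sumrN; apply: eq_bigr => i _; rewrite scaleNr.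
- by rewrite IHa scaler_sumr; apply: eq_bigr => i _; rewrite scalerA.
Qed.

Lemma leval_eq env e1 e2 :
  lcoef_eq e1 e2 (size env) -> leval env e1 = leval env e2.
Proof.
rewrite !levalE; elim: (size env) => [|n IH] /=; first by rewrite !big_ord0.
by case=> E /IH IHE; rewrite !big_ord_recr /= IHE E.
Qed.

End Lexpr.

(* Atoms are recognised up to syntactic equality only. *)
Ltac lm_mem x l := match l with
  | nil => constr:(false) | cons x _ => constr:(true) | cons _ ?l' => lm_mem x l' end.
Ltac lm_index x l := match l with
  | cons x _ => constr:(O) | cons _ ?l' => let n := lm_index x l' in constr:(S n) end.
Ltac lm_env t env := match t with
  | (?a + ?b)%R => let env1 := lm_env a env in lm_env b env1
  | (- ?a)%R => lm_env a env
  | (_ *: ?a)%R => lm_env a env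
  | 0%R => env
  | _ => match lm_mem t env with true => env | false => constr:(cons t env) end
  end.
Ltac lm_reify R t env := match t with
  | (?a + ?b)%R => let x := lm_reify R a env in let y := lm_reify R b env in
      constr:(@LAdd R x y)
  | (- ?a)%R => let x := lm_reify R a env in constr:(@LOpp R x)
  | (?c *: ?a)%R => let x := lm_reify R a env in constr:(@LScale R c x)
  | 0%R => constr:(@LZero R)
  | _ => let k := lm_index t env in constr:(@LVar R k)
  end.
Ltac lmod_with R V tac := match goal with
  | |- ?a = ?b =>
    let env0 := lm_env a (@nil V) in let env := lm_env b env0 in
    let x := lm_reify R a env in let y := lm_reify R b env in
    change (@leval R V env x = @leval R V env y);
    apply: leval_eq; cbn [lcoef_eq lcoef size Nat.eqb];
    repeat (split; [tac|]); exact I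
  end.
Tactic Notation "lmodule" constr(R) constr(V) := lmod_with R V ltac:(by ring).
Tactic Notation "lmodule_field" constr(R) constr(V) := lmod_with R V ltac:(by field).

(** * Norming functionals *)

(** Hahn-Banach: a minimal element among the sublinear functionals below the
    norm is linear, and Zorn's lemma provides one below any given functional. *)
Section HahnBanach.
Variables (R : realType) (Z : normedModType R).

Definition sublinear (q : Z -> R) :=
  [/\ forall a v, 0 <= a -> q (a *: v) = a * q v,
      forall u v, q (u + v) <= q u + q v
    & forall v, q v <= `|v| ].

Lemma sublinear0 q : sublinear q -> q 0 = 0.
Proof. by case=> qZ _ _; have := qZ 0 0 (lexx 0); rewrite scale0r mul0r. Qed.

Lemma sublinear_ge q v : sublinear q -> - `|v| <= q v.
Proof.
move=> sq; have [_ qD qn] := sq; have := qD v (- v); rewrite subrr (sublinear0 sq).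
by have := qn (- v); rewrite normrN; lra.
Qed.

(** The greatest sublinear functional below [q] whose value at [- x] is at
    most [- q x]. *)
Definition lower_along (q : Z -> R) (x v : Z) : R :=
  inf [set q (v + s *: x) - s * q x | s in [set s : R | 0 <= s]].

Section lower_along.
Variables (q : Z -> R) (sq : sublinear q) (x : Z).

Lemma lower_along_lb v s : 0 <= s -> - `|v| <= q (v + s *: x) - s * q x.
Proof.
move=> s0; have [qZ qD qn] := sq.
have := qD (v + s *: x) (- v); rewrite addrAC subrr add0r qZ //.
by have := qn (- v); rewrite normrN; lra.
Qed.

Lemma lower_along_le v s : 0 <= s -> lower_along q x v <= q (v + s *: x) - s * q x.
Proof.
move=> s0; apply: ge_inf; last by exists s.
by exists (- `|v|) => _ [s' /= s'0 <-]; apply: lower_along_lb.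
Qed.

Lemma le_lower_along v b :
  (forall s, 0 <= s -> b <= q (v + s *: x) - s * q x) -> b <= lower_along q x v.
Proof.
move=> H; apply: lb_le_inf; first by exists (q (v + 0 *: x) - 0 * q x); exists 0 => /=.
by move=> _ [s /= s0 <-]; apply: H.
Qed.

Lemma lower_along_le_self v : lower_along q x v <= q v.
Proof. by have := @lower_along_le v 0 (lexx 0); rewrite scale0r mul0r addr0 subr0. Qed.

Lemma lower_along_opp : lower_along q x (- x) <= - q x.
Proof.
have := @lower_along_le (- x) 1 ler01.
by rewrite scale1r mul1r addNr (sublinear0 sq) sub0r.
Qed.

Lemma lower_along_sublinear : sublinear (lower_along q x).
Proof.
have [qZ qD qn] := sq; split; last first.
- by move=> v; apply: le_trans (lower_along_le_self v) (qn v).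
- move=> u v.
  have H s s' : 0 <= s -> 0 <= s' ->
      lower_along q x (u + v) - (q (u + s *: x) - s * q x) <= q (v + s' *: x) - s' * q x.
    move=> s0 s'0; have := @lower_along_le (u + v) (s + s') (addr_ge0 s0 s'0).
    have := qD (u + s *: x) (v + s' *: x).
    by rewrite addrACA -scalerDl; lra.
  have {}H s : 0 <= s -> lower_along q x (u + v) - lower_along q x v <= q (u + s *: x) - s * q x.
    move=> s0; have : lower_along q x (u + v) - (q (u + s *: x) - s * q x) <= lower_along q x v.
      by apply: le_lower_along => s' s'0; apply: H.
    by lra.
  by have := @le_lower_along u _ H; lra.
have H a v : 0 < a -> lower_along q x (a *: v) <= a * lower_along q x v.
  move=> a0; rewrite mulrC -ler_pdivrMr //; apply: le_lower_along => s s0.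
  rewrite ler_pdivrMr //; have := @lower_along_le (a *: v) (a * s) (mulr_ge0 (ltW a0) s0).
  by rewrite -scalerA -scalerDr (qZ _ _ (ltW a0)); lra.
move=> a v; rewrite le_eqVlt => /orP[/eqP<-|a0].
  rewrite scale0r mul0r; apply/eqP; rewrite eq_le.
  rewrite (le_trans (lower_along_le_self 0)) ?(sublinear0 sq) //=.
  by apply: le_lower_along => s s0; rewrite add0r qZ // subrr.
apply/eqP; rewrite eq_le H //= mulrC -ler_pdivlMr // mulrC.
have ai : 0 < a^-1 by rewrite invr_gt0.
by have := H _ (a *: v) ai; rewrite scalerA mulVf ?gt_eqF // scale1r.
Qed.

End lower_along.

Lemma minimal_sublinear (q0 : Z -> R) : sublinear q0 ->
  exists q, [/\ sublinear q, forall v, q v <= q0 v &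
    forall q', sublinear q' -> (forall v, q' v <= q v) -> forall v, q' v = q v].
Proof.
move=> sq0.
pose T := {q : Z -> R | sublinear q /\ forall v, q v <= q0 v}.
pose Rel (p q : T) := `[< forall v, sval q v <= sval p v >].
pose t0 : T := exist _ q0 (conj sq0 (fun=> lexx _)).
have [||A Atot|m mmax] := @ZL_preorder T t0 Rel.
- by move=> t; apply/asboolP.
- move=> p q r /asboolP pq /asboolP qr; apply/asboolP => v; exact: le_trans (qr v) (pq v).
- have [[a Aa]|A0] := pselect (A !=set0); last first.
    by exists t0 => s As; case: A0; exists s.
  pose i v := inf [set sval q v | q in A].
  have i_le q v : A q -> i v <= sval q v.
    move=> Aq; apply: ge_inf; last by exists q.
    by exists (- `|v|) => _ [[s [ss ?]] _ <-] /=; apply: sublinear_ge.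
  have le_i b v : (forall q, A q -> b <= sval q v) -> b <= i v.
    move=> H; apply: lb_le_inf; first by exists (sval a v), a.
    by move=> _ [q Aq <-]; apply: H.
  have i_sub : sublinear i.
    split; last first.
    - move=> v; apply: le_trans (i_le _ v Aa) _.
      by case: (a) => /= q [[_ _ qn] _].
    - move=> u v.
      have H p q : A p -> A q -> i (u + v) <= sval p u + sval q v.
        move=> Ap Aq; have [_ pD _] := (svalP p).1; have [_ qD _] := (svalP q).1.
        have [/asboolP pq|/asboolP qp] := Atot p q Ap Aq.
          apply: le_trans (i_le _ _ Aq) _; apply: le_trans (qD _ _) _.
          by rewrite lerD2r.
        apply: le_trans (i_le _ _ Ap) _; apply: le_trans (pD _ _) _.
        by rewrite lerD2l.
      have {}H p : A p -> i (u + v) - sval p u <= i v.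
        by move=> Ap; apply: le_i => q Aq; rewrite lerBlDl H.
      have : i (u + v) - i v <= i u by apply: le_i => p /H; lra.
      by lra.
    have H c v : 0 < c -> i (c *: v) <= c * i v.
      move=> c0; rewrite mulrC -ler_pdivrMr //; apply: le_i => q Aq.
      rewrite ler_pdivrMr //; have := i_le _ (c *: v) Aq.
      by have [qZ _ _] := (svalP q).1; rewrite qZ ?(ltW c0) // mulrC.
    move=> c v; rewrite le_eqVlt => /orP[/eqP<-|c0].
      rewrite scale0r mul0r; apply/eqP; rewrite eq_le.
      apply/andP; split; last by apply: le_i => q Aq; rewrite sublinear0 //; case: (svalP q).
      by apply: le_trans (i_le _ _ Aa) _; rewrite sublinear0 //; case: (svalP a).
    apply/eqP; rewrite eq_le H //= mulrC -ler_pdivlMr // mulrC.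
    have ci : 0 < c^-1 by rewrite invr_gt0.
    by have := H _ (c *: v) ci; rewrite scalerA mulVf ?gt_eqF // scale1r.
  have i0 v : i v <= q0 v by apply: le_trans (i_le _ v Aa) _; case: (svalP a).
  by exists (exist _ i (conj i_sub i0)) => q Aq; apply/asboolP => v; apply: i_le.
exists (sval m); have [sm m0] := svalP m; split => // q' sq' q'm v.
have q'0 u : q' u <= q0 u by apply: le_trans (q'm u) (m0 u).
apply/eqP; rewrite eq_le q'm /=.
have /asboolP := mmax (exist _ q' (conj sq' q'0)) (asboolT q'm).
by apply.
Qed.

(** Starting from [lower_along] of the norm along [x] forces the value
    [`|x|] at [x]. A minimal [q] coincides with [lower_along q u] for every
    [u], whence [q (- u) <= - q u]: it is odd, hence linear. *)
Lemma norming_functional (x : Z) : exists phi : Z -> R,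
  [/\ forall u v, phi (u + v) = phi u + phi v,
      forall a v, phi (a *: v) = a * phi v,
      forall v, phi v <= `|v| & phi x = `|x| ].
Proof.
have sn : sublinear (fun v : Z => `|v|).
  by split=> // [a v a0|]; [rewrite normrZ ger0_norm | exact: ler_normD].
have [q [sq qle qmin]] := minimal_sublinear (lower_along_sublinear sn x).
have [qZ qD qn] := sq.
have qN u : q (- u) = - q u.
  apply/eqP; rewrite eq_le; apply/andP; split.
    have <- := qmin _ (lower_along_sublinear sq u) (lower_along_le_self sq u) (- u).
    exact: lower_along_opp.
  by have := qD u (- u); rewrite subrr (sublinear0 sq); lra.
have qx : q x = `|x|.
  apply/eqP; rewrite eq_le qn /=; have := qle (- x); rewrite qN.
  by have := lower_along_opp sn x; lra.
exists q; split=> // [u v|a v].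
  apply/eqP; rewrite eq_le qD /=; have := qD (u + v) (- v).
  by rewrite addrK qN; lra.
have [a0|/ltW a0] := leP 0 a; first exact: qZ.
by have := qZ (- a) v; rewrite oppr_ge0 scaleNr qN => /(_ a0); lra.
Qed.

End HahnBanach.

(** * Finite nets modulo a subspace of finite codimension *)

Definition linear_subspace (R : realType) (Z : normedModType R) (W : set Z) :=
  W 0 /\ forall a u v, W u -> W v -> W (a *: u + v).

Lemma submod_closedE (R : realType) (Z : normedModType R) (W : set Z) :
  GRing.submod_closed [in W] <-> linear_subspace W.
Proof.
split=> -[W0 WD]; split.
- by move: W0; rewrite in_setE.
- by move=> a u v Wu Wv; apply/set_mem/WD; apply/mem_set.
- by apply/mem_set.
- by move=> a u v /set_mem Wu /set_mem Wv; apply/mem_set/WD.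
Qed.

Section Subspace.
Variables (R : realType) (Z : normedModType R) (W : set Z).
Hypothesis sW : linear_subspace W.

Lemma subspaceD u v : W u -> W v -> W (u + v).
Proof. by have [_ H] := sW; move=> Wu Wv; rewrite -[u]scale1r; apply: H. Qed.

Lemma subspaceZ a u : W u -> W (a *: u).
Proof. by have [W0 H] := sW; move=> Wu; rewrite -[_ *: _]addr0; apply: H. Qed.

Lemma subspaceN u : W u -> W (- u).
Proof. by rewrite -scaleN1r; apply: subspaceZ. Qed.

Lemma subspace_sum (I : finType) (F : I -> Z) :
  (forall i, W (F i)) -> W (\sum_i F i).
Proof. by move=> H; elim/big_ind: _ => //; [case: sW | exact: subspaceD]. Qed.

End Subspace.

Section FiniteNet.
Variables (R : realType) (Z : normedModType R) (W : set Z).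
Hypothesis sW : linear_subspace W.

(** Bounded subsets of [U] are totally bounded modulo [W]. *)
Definition bounded_nets (U : set Z) := forall rho eta : R, 0 < eta ->
  exists F : seq Z, forall z, U z -> `|z| <= rho ->
    exists2 x, x \in F & exists2 w, W w & `|z - x - w| <= eta.

Definition extend (U : set Z) (e : Z) : set Z :=
  [set z | exists a : R, U (z - a *: e)].

Lemma extend_subspace U e : linear_subspace U -> linear_subspace (extend U e).
Proof.
move=> sU; have [U0 UD] := sU; split; first by exists 0; rewrite scale0r subr0.
move=> a u v [b Ub] [c Uc]; exists (a * b + c).
suff -> : a *: u + v - (a * b + c) *: e = a *: (u - b *: e) + (v - c *: e).
  exact: UD.
by rewrite scalerDl -scalerA scalerBr opprD addrACA.
Qed.

(** If [e] is a limit of vectors of [U], vectors of [extend U e] are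
    approximated by vectors of [U]. Otherwise [e] is at distance at least
    [d > 0] from [U], which bounds the coefficient of [e] in a bounded vector,
    and a net of coefficients is combined with a net of [U]. *)
Lemma bounded_nets_extend U e :
  linear_subspace U -> bounded_nets U -> bounded_nets (extend U e).
Proof.
move=> sU tU rho eta eta0.
have eta20 : 0 < eta / 2 by rewrite divr_gt0.
have [near|far] := pselect (forall d : R, 0 < d -> exists2 u, U u & `|e - u| <= d).
  have [F HF] := tU (rho + eta / 2) _ eta20.
  exists F => z [a Ua] zrho.
  have a1 : 0 < `|a| + 1 by rewrite ltr_wpDl.
  have [u Uu ue] := near (eta / 2 / (`|a| + 1)) (divr_gt0 eta20 a1).
  pose u' := a *: u + (z - a *: e).
  have Uu' : U u' by case: sU => _; apply.
  have zu' : `|z - u'| <= eta / 2.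
    rewrite (_ : z - u' = a *: (e - u)); last by rewrite /u'; lmodule R Z.
    rewrite normrZ; apply: (@le_trans _ _ (`|a| * (eta / 2 / (`|a| + 1)))).
      by rewrite ler_wpM2l.
    rewrite mulrA ler_pdivrMr // mulrC ler_wpM2l ?ltW //; lra.
  have u'rho : `|u'| <= rho + eta / 2.
    by have := ler_normB z (z - u'); rewrite opprB addrC subrK; lra.
  have [x xF [w Ww xw]] := HF u' Uu' u'rho; exists x => //; exists w => //.
  have := ler_normD (z - u') (u' - x - w).
  rewrite (_ : z - u' + (u' - x - w) = z - x - w); last by lmodule R Z.
  lra.
have [d d0 dU] : exists2 d : R, 0 < d & forall u, U u -> d < `|e - u|.
  apply: contra_notP far => H d d0; apply: contrapT => H'; apply: H.
  by exists d => // u Uu; rewrite ltNge; apply/negP => le_d; apply: H'; exists u.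
(* A bounds the coefficient of e, and h is the step of the coefficient net. *)
pose A := `|rho| / d; pose h := eta / 2 / (`|e| + 1).
have A0 : 0 <= A by rewrite divr_ge0 // ltW.
have e1 : 0 < `|e| + 1 by rewrite ltr_wpDl.
have h0 : 0 < h by rewrite divr_gt0.
have [F HF] := tU (rho + A * `|e|) _ eta20.
pose N := Num.truncn (2 * A / h).
exists [seq x + (- A + j%:R * h) *: e | x <- F, j <- iota 0 N.+1].
move=> z [a Ua] zrho.
have aA : `|a| <= A.
  have [->|a0] := eqVneq a 0; first by rewrite normr0.
  rewrite ler_pdivlMr //; apply: le_trans (ler_norm rho); apply: le_trans zrho.
  have := dU _ (subspaceZ sU (- a^-1) Ua).
  have a0' : 0 < `|a| by rewrite normr_gt0.
  rewrite (_ : e - _ = a^-1 *: z); last by lmodule_field R Z.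
  rewrite normrZ normfV.
  by rewrite -(ltr_pM2l a0') mulrA divff ?gt_eqF // mul1r => /ltW.
have [x xF [w Ww xw]] : exists2 x, x \in F & exists2 w, W w & `|z - a *: e - x - w| <= eta / 2.
  apply: HF => //; apply: le_trans (ler_normB _ _) _; rewrite normrZ lerD //.
  by rewrite ler_wpM2r.
have aA0 : 0 <= (a + A) / h.
  by rewrite divr_ge0 ?(ltW h0) //; move: aA; rewrite ler_norml; lra.
pose j := Num.truncn ((a + A) / h).
have /andP[j1 j2] : j%:R <= (a + A) / h < j.+1%:R by rewrite /j truncn_itv.
have jN : (j <= N)%N.
  apply: le_truncn; rewrite ler_pM2r ?invr_gt0 //.
  by move: aA; rewrite ler_norml; lra.
have ah : `|a - (- A + j%:R * h)| <= h.
  move: j1 j2; rewrite ler_pdivlMr // ltr_pdivrMr // -natr1 => j1 j2.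
  by rewrite ler_norml; apply/andP; split; lra.
exists (x + (- A + j%:R * h) *: e).
  by apply/allpairsP; exists (x, j); split => //; rewrite mem_iota.
exists w => //.
have -> : z - (x + (- A + j%:R * h) *: e) - w =
    (z - a *: e - x - w) + (a - (- A + j%:R * h)) *: e.
  by lmodule R Z.
apply: le_trans (ler_normD _ _) _; rewrite [leRHS]splitr lerD //.
rewrite normrZ; apply: (@le_trans _ _ (h * `|e|)); first by rewrite ler_wpM2r.
by rewrite /h -mulrA ler_piMr ?(ltW eta20) // ler_pdivrMl // mulr1; lra.
Qed.

Lemma bounded_nets_span n (e : 'I_n -> Z) (U : set Z) :
  linear_subspace U -> bounded_nets U ->
  bounded_nets [set z | exists a : 'I_n -> R, U (z - \sum_(i < n) a i *: e i)].
Proof.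
elim: n e U => [|n IH] e U sU tU.
  move=> rho eta /(tU rho)[F HF]; exists F => z [a]; rewrite big_ord0 subr0.
  exact: HF.
have := IH (fun i => e (widen_ord (leqnSn n) i)) _ (extend_subspace (e ord_max) sU)
  (bounded_nets_extend (e ord_max) sU tU).
move=> H rho eta /(H rho)[F HF]; exists F => z [a Ua]; apply: HF.
exists (fun i => a (widen_ord (leqnSn n) i)); exists (a ord_max).
by move: Ua; rewrite big_ord_recr /= opprD addrA.
Qed.

(** The points of a net can be moved into the ball: each of them is replaced by
    a vector of the ball close to it modulo [W], if there is one. *)
Lemma ball_net (delta : R) : finite_codim W ->
  exists F : seq Z, (forall x, x \in F -> `|x| <= delta) /\
    forall z, `|z| <= delta ->
      exists2 x, x \in F & exists2 w, W w & `|z - x - w| <= 1.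
Proof.
move=> [n [e He]].
have tW : bounded_nets W.
  move=> rho eta eta0; exists [:: 0] => z Wz _; exists 0; rewrite ?inE //.
  by exists z => //; rewrite subr0 subrr normr0 ltW.
have [|F HF] := @bounded_nets_span n e W sW tW delta 2^-1.
  by rewrite invr_gt0.
pose close x z := `|z| <= delta /\ exists2 w, W w & `|z - x - w| <= 2^-1.
pose F' := [seq x <- F | `[< exists z, close x z >]].
pose rep x := xget 0 [set z | close x z].
have repP x z : close x z -> close x (rep x).
  by move=> xz; apply: (@xgetPex _ 0 [set z | close x z]); exists z.
exists [seq rep x | x <- F']; split.
  move=> _ /mapP[x + ->]; rewrite mem_filter => /andP[/asboolP[z xz] _].
  by have [] := repP _ _ xz.
move=> z zd; have [x xF [w Ww xw]] := HF z (He z) zd.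
have xz : close x z by split => //; exists w.
exists (rep x).
  by apply: map_f; rewrite mem_filter xF andbT; apply/asboolP; exists z.
have [_ [w' Ww' xw']] := repP _ _ xz.
exists (w - w'); first by apply: subspaceD => //; apply: subspaceN.
have -> : z - rep x - (w - w') = (z - x - w) - (rep x - x - w').
  by lmodule R Z.
by apply: le_trans (ler_normB _ _) _; rewrite [leRHS]splitr mul1r lerD.
Qed.

End FiniteNet.

(** * The Gorelik principle *)

Section ApproximateZero.
Variables (R : realType) (Z : normedModType R) (W : set Z).
Hypotheses (sW : linear_subspace W) (fW : finite_codim W).

(** A finite substitute for Brouwer's theorem in [Z / W]: a perturbation of the
    identity by at most [delta] on the ball of radius [delta] comes close to
    [W], at a point of a finite set [G] chosen before the perturbation.

    [G] is the image of a simplex grid under the affine map onto the convex hull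
    of a finite net [x] of the ball modulo [W], and a grid point is labelled by
    an [i] such that [x i] is close to [- psi] modulo [W]. At the point [a]
    given by [simplex_grid_kkm], [- psi a] is close modulo [W] to each [x i]
    carried by [a], hence to their barycentre, which is [a]. *)
Lemma approximate_zero (delta : R) : 0 <= delta ->
  exists G : seq Z, (forall a, a \in G -> `|a| <= delta) /\
    forall (psi : Z -> Z) (kappa : R), 0 <= kappa ->
      (forall a, `|a| <= delta -> `|psi a| <= delta) ->
      (forall a a', `|a - a'| <= 1 -> `|psi a - psi a'| <= kappa) ->
      exists2 a, a \in G & exists2 w, W w & `|a + psi a - w| <= kappa + 3.
Proof.
move=> d0; have [F [Fd HF]] := ball_net sW delta fW.
pose I := 'I_(size F); pose x (i : I) := nth 0 F i.
have xd i : `|x i| <= delta by apply: Fd; apply: mem_nth.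
have [y0 y0F _] := HF 0 (eq_ind_r (fun u => u <= delta) d0 (normr0 Z)).
have i1 : I by exists (index y0 F); rewrite index_mem.
pose N := (#|{: I}|%:R : R).
pose p := (Num.truncn (N * N * delta)).+1.
have p0 : 0 < p%:R :> R by rewrite ltr0n.
have N0 : 0 <= N by rewrite ler0n.
(* The mesh is fine enough for N steps in each of N coordinates to move a
   point by at most 1. *)
have small : N * (N / p%:R * delta) <= 1.
  rewrite (_ : N * _ = N * N * delta / p%:R); last by ring.
  by rewrite ler_pdivrMr // mul1r ltW // truncnS_gt.
pose nu (l : grid I p) i := (val l i : nat)%:R / p%:R : R.
have nu0 l i : 0 <= nu l i by rewrite divr_ge0 // ler0n.
have nu1 l : \sum_i nu l i = 1.
  by rewrite -mulr_suml -natr_sum grid_sum divff // gt_eqF.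
pose pt l := \sum_i nu l i *: x i.
have sumN (u : I -> R) b : (forall i, u i <= b) -> \sum_i u i <= N * b.
  move=> ub; apply: le_trans (ler_sum _ (fun i _ => ub i)) _.
  by rewrite sumr_const -mulr_natl.
have ptd l : `|pt l| <= delta.
  apply: le_trans (ler_norm_sum _ _ _) _.
  rewrite -[delta]mul1r -(nu1 l) mulr_suml ler_sum // => i _.
  by rewrite normrZ ger0_norm // ler_wpM2l.
have ptclose (l l' : grid I p) : (forall j, (val l j <= val l' j + #|{: I}|)%N /\
    (val l' j <= val l j + #|{: I}|)%N) -> `|pt l - pt l'| <= 1.
  move=> H; rewrite -sumrB; apply: le_trans (ler_norm_sum _ _ _) _.
  apply: le_trans small; apply: sumN => i.
  rewrite -scalerBl normrZ; apply: ler_pM => //.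
  have pi0 : 0 <= p%:R^-1 :> R by rewrite invr_ge0 ltW.
  rewrite -mulrBl normrM [X in _ * X](ger0_norm pi0) ler_wpM2r //.
  have [h1 h2] := H i.
  rewrite ler_norml; apply/andP; split.
    by rewrite lerNl opprB lerBlDr -natrD ler_nat addnC.
  by rewrite lerBlDr -natrD ler_nat addnC.
exists [seq pt l | l <- enum {: grid I p}]; split; first by move=> _ /mapP[l _ ->].
move=> psi kappa kappa0 psid psi_osc.
have /choice[c cP] : forall l, exists i : I,
    exists2 w, W w & `|- psi (pt l) - x i - w| <= 1.
  move=> l; have [|y yF Hy] := HF (- psi (pt l)); first by rewrite normrN psid.
  have yi : (index y F < size F)%N by rewrite index_mem.
  by exists (Ordinal yi); rewrite /x /= nth_index.
have [C [l0 [l [lc lclose lsmall]]]] := simplex_grid_kkm i1 c.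
set a := pt l0; exists a; first by apply: map_f; rewrite mem_enum.
(* Off C the coordinates of a are small, so w = 0 and the crude bound 2 * delta
   on the summand are enough. *)
have /choice[w wP] : forall i : I, exists w, W w /\
    (`|- psi a - x i - w| <= kappa + 1 \/ w = 0 /\ i \notin C).
  move=> i.
  have [iC|iC] := boolP (i \in C); last by exists 0; split; [case: sW|right].
  have [w Ww Hw] := cP (l i); exists w; split => //; left.
  rewrite lc // in Hw.
  rewrite (_ : _ - w = (psi (pt (l i)) - psi a) + (- psi (pt (l i)) - x i - w)); last first.
    by lmodule R Z.
  apply: le_trans (ler_normD _ _) (lerD _ Hw).
  by apply/psi_osc/ptclose/lclose.
exists (- \sum_i nu l0 i *: w i).
  by apply: (subspaceN sW); apply: (subspace_sum sW) => i; apply: (subspaceZ sW); case: (wP i).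
have -> : a + psi a - - \sum_i nu l0 i *: w i =
    - \sum_i nu l0 i *: (- psi a - x i - w i).
  have -> : \sum_i nu l0 i *: (- psi a - x i - w i) =
      \sum_i nu l0 i *: (- psi a) - \sum_i nu l0 i *: x i - \sum_i nu l0 i *: w i.
    by rewrite -!sumrB; apply: eq_bigr => i _; lmodule R Z.
  by rewrite -scaler_suml nu1 -/(pt l0) -/a; lmodule R Z.
rewrite normrN; apply: le_trans (ler_norm_sum _ _ _) _.
apply: (@le_trans _ _ (\sum_i (nu l0 i * (kappa + 1) + N / p%:R * (2 * delta)))).
  apply: ler_sum => i _; rewrite normrZ (ger0_norm (nu0 _ _)).
  have Np0 : 0 <= N / p%:R by rewrite divr_ge0 // ltW.
  have [_ [H|[-> iC]]] := wP i.
    by rewrite -[leLHS]addr0 lerD ?ler_wpM2l // mulr_ge0 // mulr_ge0.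
  rewrite -[leLHS]add0r lerD //; first by rewrite mulr_ge0 //; lra.
  apply: ler_pM => //.
    by rewrite ler_pM2r ?invr_gt0 // ler_nat lsmall.
  rewrite subr0; have := ler_normB (- psi a) (x i); rewrite normrN.
  by have := psid _ (ptd l0); have := xd i; rewrite -/a; lra.
rewrite big_split /= -mulr_suml nu1 mul1r.
have := sumN (fun=> N / p%:R * (2 * delta)) _ (fun=> lexx _).
have -> : N * (N / p%:R * (2 * delta)) = 2 * (N * (N / p%:R * delta)) by ring.
by move: small; lra.
Qed.

End ApproximateZero.

(** Two points at distance less than [s] are compared through a third one at
    distance [2 * s] from the first; this needs a non-zero vector. *)
Lemma coarse_affine (R : realType) (V W : normedModType R) (h : V -> W) (K : R)
    (v0 : V) : v0 != 0 -> (Lip_infty h < K%:E)%E ->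
  exists2 C : R, 0 <= C & forall x x', `|h x - h x'| <= K * `|x - x'| + C.
Proof.
move=> v00 /ereal_inf_lt[_ [s /= s0 <-] HK].
have far x x' : s <= `|x - x'| -> `|h x - h x'| <= K * `|x - x'|.
  move=> sx; have x0 : 0 < `|x - x'| by apply: lt_le_trans sx.
  rewrite -ler_pdivrMr // -lee_fin; apply: le_trans (ltW HK).
  by apply: ereal_sup_ubound; exists (x, x').
pose v := (2 * s / `|v0|) *: v0.
have v0n : 0 < `|v0| by rewrite normr_gt0.
have vn : `|v| = 2 * s.
  rewrite normrZ ger0_norm; last by rewrite divr_ge0 // mulr_ge0 // ltW.
  by rewrite divfK // gt_eqF.
have K0 : 0 <= K.
  have := far v 0; rewrite subr0 vn => H.
  have : s <= 2 * s by lra.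
  move/H => {}H; have : 0 <= K * (2 * s) by apply: le_trans H.
  by rewrite pmulr_lge0 //; lra.
have Ks : 0 <= K * s by rewrite mulr_ge0 // ltW.
exists (5 * (K * s)); first by lra.
move=> x x'; have [sx|sx] := leP s `|x - x'|; first by have := far _ _ sx; lra.
have h1 := far x (x + v); have h2 := far (x + v) x'.
have e1 : `|x - (x + v)| = 2 * s by rewrite opprD addrA subrr add0r normrN.
have e2 : `|x + v - x'| <= 3 * s.
  by have := ler_normD (x - x') v; rewrite addrAC vn; lra.
have e3 : s <= `|x + v - x'|.
  by have := ler_normB (x + v - x') (x - x'); rewrite opprB addrA subrK addrAC subrr add0r vn; lra.
rewrite e1 in h1; have {}h1 := h1 _; have {}h2 := h2 e3.
have {}h1 : `|h x - h (x + v)| <= K * (2 * s) by apply: h1; lra.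
have := ler_normD (h x - h (x + v)) (h (x + v) - h x'); rewrite addrA subrK => h3.
have h4 : K * `|x + v - x'| <= K * (3 * s) by rewrite ler_wpM2l.
have h5 : 0 <= K * `|x - x'| by rewrite mulr_ge0.
by lra.
Qed.

(** The Gorelik principle, up to a bounded error: [f] maps large balls of
    subspaces of finite codimension onto large balls of [Y], up to finitely
    many translations. The map [a |-> g (f (m + a) + u) - m] is a bounded
    perturbation of the identity, so it comes close to some [w] in [W]; applying
    [f] shows that [f (m + w)] is close to [f (m + a) + u]. *)
Lemma gorelik_principle (R : realType) (X Y : normedModType R) (f : X -> Y) (g : Y -> X)
    (A B Cf Cg C : R) : 0 <= A -> 0 <= B -> 0 <= Cf -> 0 <= Cg -> 0 <= C ->
  (forall x x', `|f x - f x'| <= A * `|x - x'| + Cf) ->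
  (forall y y', `|g y - g y'| <= B * `|y - y'| + Cg) ->
  (forall x, `|g (f x) - x| <= C) -> (forall y, `|f (g y) - y| <= C) ->
  exists2 E : R, 0 <= E & forall (W : set X) (m : X) (delta b : R),
    linear_subspace W -> finite_codim W -> 0 <= b -> B * b + Cg + C <= delta ->
    exists G : seq Y, forall u, `|u| <= b -> exists2 k, k \in G &
      exists w, [/\ W w, `|w| <= 2 * delta + E & `|f (m + w) - k - u| <= E].
Proof.
move=> A0 B0 Cf0 Cg0 C0 fA gB gf fg.
pose kappa := B * (A + Cf) + Cg + 1.
have kappa0 : 0 <= kappa by rewrite !addr_ge0 // mulr_ge0 // addr_ge0.
pose E := A * (kappa + 3) + Cf + C.
have Ak : 0 <= A * (kappa + 3) by rewrite mulr_ge0 // addr_ge0.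
have E0 : 0 <= E by rewrite /E; lra.
exists (E + (kappa + 3)); first by lra.
move=> W m delta b sW fW b0 Bb.
have d0 : 0 <= delta by apply: le_trans Bb; rewrite !addr_ge0 // mulr_ge0.
have [G [Gd HG]] := approximate_zero sW fW d0.
exists [seq f (m + a) | a <- G] => u ub.
pose psi a := g (f (m + a) + u) - (m + a).
have psid a : `|a| <= delta -> `|psi a| <= delta.
  move=> _; apply: le_trans Bb.
  rewrite (_ : psi a = (g (f (m + a) + u) - g (f (m + a))) + (g (f (m + a)) - (m + a))); last first.
    by rewrite /psi; lmodule R X.
  apply: le_trans (ler_normD _ _) _; rewrite lerD //.
  apply: le_trans (gB _ _) _; rewrite lerD // ler_wpM2l //.
  by rewrite addrAC subrr add0r.
have psi_osc a a' : `|a - a'| <= 1 -> `|psi a - psi a'| <= kappa.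
  move=> aa'; rewrite (_ : _ - _ = (g (f (m + a) + u) - g (f (m + a') + u)) - (a - a')); last first.
    by rewrite /psi; lmodule R X.
  apply: le_trans (ler_normB _ _) _; rewrite lerD //.
  apply: le_trans (gB _ _) _; rewrite lerD // ler_wpM2l //.
  rewrite (_ : _ - _ = f (m + a) - f (m + a')); last by lmodule R Y.
  apply: le_trans (fA _ _) _; rewrite lerD //.
  by rewrite (_ : _ - _ = a - a') ?ler_piMr //; lmodule R X.
have [a aG [w Ww aw]] := HG psi kappa kappa0 psid psi_osc.
exists (f (m + a)); first exact: map_f.
exists w; split=> //.
  have := ler_normB (a + psi a) (a + psi a - w).
  rewrite opprB addrC subrK => wn.
  have := ler_normD a (psi a); have := Gd a aG; have := psid a (Gd a aG).
  by move: wn; lra.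
set y := f (m + a) + u.
rewrite (_ : _ - u = (f (m + w) - f (g y)) + (f (g y) - y)); last by rewrite /y; lmodule R Y.
apply: le_trans (ler_normD _ _) _.
have h1 := fA (m + w) (g y); have h2 := fg y.
have h3 : `|m + w - g y| <= kappa + 3.
  by rewrite distrC (_ : _ - _ = a + psi a - w) // /psi -/y; lmodule R X.
have h4 : A * `|m + w - g y| <= A * (kappa + 3) by rewrite ler_wpM2l.
by rewrite /E; lra.
Qed.

(** * Common kernels of norming functionals *)

(** Either [phi] vanishes on [V], or a vector [v0] of [V] outside the kernel is
    enough to complete a spanning family. *)
Lemma kernel_codim (R : realType) (Z : normedModType R) (V : set Z) (phi : Z -> R) :
  (forall u v, phi (u + v) = phi u + phi v) ->
  (forall a v, phi (a *: v) = a * phi v) -> (forall v, phi v <= `|v|) ->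
  closed_finite_codim_subspace V ->
  closed_finite_codim_subspace (V `&` [set v | phi v = 0]).
Proof.
move=> phiD phiZ phin [/submod_closedE sV cV [n [e He]]].
have phiN v : phi (- v) = - phi v by rewrite -scaleN1r phiZ mulN1r.
have phiB u v : `|phi u - phi v| <= `|u - v|.
  rewrite -phiN -phiD ler_norml phin andbT lerNl -phiN opprB -normrN opprB.
  exact: phin.
split.
- apply/submod_closedE; split; first by split; [case: sV | rewrite /= -(scale0r (0 : Z)) phiZ mul0r].
  move=> a u v [Vu pu] [Vv pv]; split; first by case: sV => _; apply.
  by rewrite /= phiD phiZ pu pv mulr0 addr0.
- apply: closedI => //.
  have phic : continuous phi.
    move=> v; apply/cvgrPdist_le => eps eps0; near=> w.
    apply: le_trans (phiB _ _) _; near: w.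
    exact: cvgr_dist_le.
  change (closed (phi @^-1` [set x | x = 0])); apply: preimage_closed.
    by move=> v _; exact: phic.
  exact: closed_eq.
have [[v0 [Vv0 pv0]]|none] := pselect (exists v, V v /\ phi v <> 0).
  exists n.+1, (fun i => if unlift ord_max i is Some j then e j else v0) => z.
  have [a Va] := He z; set v := z - _ in Va.
  exists (fun i => if unlift ord_max i is Some j then a j else phi v / phi v0).
  rewrite big_ord_recr /= unlift_none (eq_bigr (fun i => a i *: e i)); last first.
    move=> i _; rewrite (_ : widen_ord _ i = lift ord_max i) ?liftK //.
    by apply: val_inj; rewrite /= /bump leqNgt ltn_ord.
  rewrite opprD addrA -/v; split.
    rewrite -scaleNr addrC; by case: sV => _; apply.
  by rewrite /= phiD -scaleNr phiZ mulNr divfK ?subrr //; apply/eqP.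
exists n, e => z; have [a Va] := He z; exists a; split => //=.
by apply: contrapT => pz; apply: none; exists (z - \sum_(i < n) a i *: e i).
Unshelve. all: by end_near. Qed.

(** Vectors in the kernel of a functional norming [k] cannot bring [k] closer
    to the origin. *)
Lemma norming_subspace (R : realType) (Z : normedModType R) (F : seq Z) :
  exists2 V : set Z, closed_finite_codim_subspace V &
    forall k v, k \in F -> V v -> `|k| <= `|k + v|.
Proof.
elim: F => [|k F [V fV HV]].
  exists setT; last by move=> k v; rewrite in_nil.
  split; first by apply/submod_closedE; split.
    exact: closedT.
  by exists 0%N, (fun=> 0) => z; exists (fun=> 0).
have [phi [phiD phiZ phin phik]] := norming_functional k.
exists (V `&` [set v | phi v = 0]); first exact: kernel_codim.
move=> k' v; rewrite inE => /orP[/eqP->|k'F] [Vv pv]; last exact: HV.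
by apply: le_trans (phin _); rewrite phiD pv addr0 phik.
Qed.

Lemma norm_segment (R : realType) (Z : normedModType R) (z a : Z) (D l : R) :
  `|z| <= D -> `|z + a| <= D -> 0 <= l <= 1 -> `|z + l *: a| <= D.
Proof.
move=> zD zaD /andP[l0 l1].
rewrite (_ : z + l *: a = (1 - l) *: z + l *: (z + a)); last by lmodule R Z.
apply: le_trans (ler_normD _ _) _; rewrite !normrZ (ger0_norm l0) ger0_norm ?subr_ge0 //.
rewrite (_ : D = (1 - l) * D + l * D); last by ring.
by rewrite lerD // ler_wpM2l // subr_ge0.
Qed.

(** Nonnegativity of [r] comes from averaging the bounds at [w1] and [- w1]. *)
Lemma sphere_to_ball (R : realType) (Z : normedModType R) (W : set Z) (z : Z) (t r : R) :
  linear_subspace W -> `|z| = 1 -> 0 < t -> (exists2 w, W w & `|w| = 1) ->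
  (forall w, W w -> `|w| = 1 -> `|z + t *: w| <= 1 + r) ->
  0 <= r /\ forall w, W w -> `|w| <= t -> `|z + w| <= 1 + r.
Proof.
move=> sW z1 t0 [w1 Ww1 w11] H.
have r0 : 0 <= r.
  have h1 := H w1 Ww1 w11; have := H (- w1) (subspaceN sW Ww1); rewrite normrN => /(_ w11) h2.
  have := ler_normD (z + t *: w1) (z + t *: - w1).
  rewrite (_ : _ + (z + t *: - w1) = 2 *: z); last by lmodule R Z.
  by rewrite normrZ z1 ger0_norm //; lra.
split=> // w Ww wt; have [->|w0] := eqVneq w 0; first by rewrite addr0 z1; lra.
have wn0 : 0 < `|w| by rewrite normr_gt0.
have Hw : `|z + t *: (`|w|^-1 *: w)| <= 1 + r.
  apply: H; first exact: subspaceZ.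
  by rewrite normrZ ger0_norm ?invr_ge0 // mulVf // gt_eqF.
have -> : z + w = z + (`|w| / t) *: (t *: (`|w|^-1 *: w)).
  by rewrite !scalerA divfK ?gt_eqF // divff ?gt_eqF // scale1r.
apply: norm_segment => //; first by rewrite z1; lra.
by rewrite divr_ge0 ?(ltW t0) //= ler_pdivrMr // mul1r.
Qed.

(** Both [y - k] and [y + k] satisfy, up to [E], the bound satisfied by [y + p]
    and [y - p], because [k] is approximately [u - p] and the last two
    hypotheses allow to drop [u]. Then [y + u / 2] is the average of [y + k]
    and [y - k + u]. *)
Lemma two_sided_bound (R : realType) (Z : normedModType R) (y k p u : Z) (D E : R) :
  `|y + p| <= D -> `|y - p| <= D -> `|p + k - u| <= E ->
  `|y - k| <= `|y - k + u| -> `|y + k| <= `|y + k - u| ->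
  `|y + 2^-1 *: u| <= D + E.
Proof.
move=> h1 h2 h3 h4 h5.
have h6 : `|y - k + u| <= D + E.
  rewrite (_ : _ + u = (y + p) - (p + k - u)); last by lmodule R Z.
  by apply: le_trans (ler_normB _ _) (lerD _ _).
have h7 : `|y + k - u| <= D + E.
  rewrite (_ : _ - u = (y - p) + (p + k - u)); last by lmodule R Z.
  by apply: le_trans (ler_normD _ _) (lerD _ _).
rewrite (_ : _ + _ = 2^-1 *: (y + k) + 2^-1 *: (y - k + u)); last by lmodule_field R Z.
apply: le_trans (ler_normD _ _) _; rewrite !normrZ ger0_norm ?invr_ge0 //.
by lra.
Qed.

(** * From approximate midpoints to the asymptotic modulus *)

(** The points [m + w], [w] in [W] with norm at most [(L / 2) * theta], are
    approximate midpoints of [s] and [t]: both distances are at most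
    [(L / 2) * (1 + r)]. Hence [p = f (m + w) - c], with [c] the middle of
    [f s] and [f s + L *: y], satisfies the bounds of [two_sided_bound] for
    [y' = (L / 2) *: y]. Vectors [u] of norm at most [b] are of the form
    [p + (c - k)] up to [E], with finitely many [k], and [V] is the
    common kernel of functionals norming [y' - (c - k)] and [y' + (c - k)].

    The vectors [k - f m] serve when [W = 0], in which case [V = 0] too:
    then [w = 0], and every [u] in [V] of norm [b] is within [E] of some
    [f m - k], which is itself of norm at most [E] by the choice of [V], whence
    the contradiction [b <= 2 * E]. *)
Lemma transfer_subspace (R : realType) (X Y : normedModType R) (f : X -> Y)
    (s t : X) (y : Y) (W : set X) (G : seq Y) (L theta r eta rho Cf b E : R) :
  0 < L -> `|s - t| = L -> 0 < theta -> 0 <= eta ->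
  (forall x x', `|f x - f x'| <= (1 + eta) * `|x - x'| + Cf) ->
  `|f t - f s - L *: y| <= eta * L ->
  linear_subspace W ->
  (forall w, W w -> `|w| = 1 -> `|L^-1 *: (t - s) + theta *: w| <= 1 + r) ->
  (forall u, `|u| <= b -> exists2 k, k \in G & exists w,
     [/\ W w, `|w| <= rho & `|f (s + 2^-1 *: (t - s) + w) - k - u| <= E]) ->
  rho <= L / 2 * theta -> 0 <= E -> 2 * E < b ->
  exists2 V : set Y, closed_finite_codim_subspace V &
    forall v, V v -> `|v| = 1 -> 0 <= r /\
      `|y + (b / L) *: v| <= (1 + eta) * (1 + r) + 2 * (Cf + E) / L + 2 * eta.
Proof.
move=> L0 stL th0 eta0 fA fst sW Wr HG rhoL E0 Eb.
set m := s + 2^-1 *: (t - s) in HG.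
pose y' := (L / 2) *: y; pose c := f s + y'.
pose F := [seq y' - (c - k) | k <- G] ++ [seq y' + (c - k) | k <- G]
  ++ [seq k - f m | k <- G].
have Fm k : k \in G -> [/\ y' - (c - k) \in F, y' + (c - k) \in F & k - f m \in F].
  move=> kG; rewrite !mem_cat; split; apply/or3P.
  - by apply: Or31; apply: (map_f (fun k => y' - (c - k))).
  - by apply: Or32; apply: (map_f (fun k => y' + (c - k))).
  - by apply: Or33; apply: (map_f (fun k => k - f m)).
have [V fV HV] := norming_subspace F; exists V => // v Vv v1.
have [sV _ _] := fV; move/submod_closedE in sV.
have b0 : 0 <= b by lra.
pose u := b *: v.
have Vu : V u by apply: (subspaceZ sV).
have ub : `|u| = b by rewrite normrZ v1 mulr1 ger0_norm.
have [k kG [w [Ww wrho wE]]] := HG u (eq_ind_r (fun x => x <= b) (lexx b) ub).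
have [F1 F2 F3] := Fm k kG.
have [W1|W0] := pselect (exists2 w, W w & `|w| = 1); last first.
  have w0 : w = 0.
    apply: contrapT => /eqP w0; apply: W0; exists (`|w|^-1 *: w).
      exact: (subspaceZ sW).
    by rewrite normrZ ger0_norm ?invr_ge0 // mulVf // normr_eq0.
  exfalso; rewrite w0 addr0 in wE.
  have h1 := HV _ _ F3 Vu.
  have h2 := ler_normB (k - f m + u) (k - f m).
  rewrite (_ : _ - (k - f m) = u) in h2; last by lmodule R Y.
  have h3 : `|k - f m + u| <= E.
    rewrite (_ : _ + u = - (f m - k - u)); last by lmodule R Y.
    by rewrite normrN.
  by lra.
set z := L^-1 *: (t - s) in Wr.
have z1 : `|z| = 1.
  by rewrite normrZ distrC stL ger0_norm ?invr_ge0 ?(ltW L0) // mulVf // gt_eqF.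
have [r0 Wb] := sphere_to_ball sW z1 th0 W1 Wr; split => //.
have Ln0 : L != 0 by rewrite gt_eqF.
have L20 : 0 < L / 2 by rewrite divr_gt0.
have scale x : W x -> `|x| <= rho -> `|(L / 2) *: z + x| <= L / 2 * (1 + r).
  move=> Wx xrho.
  rewrite (_ : _ + x = (L / 2) *: (z + (L / 2)^-1 *: x)); last first.
    by rewrite scalerDr (scalerA _ _ x) divff ?gt_eqF // scale1r.
  rewrite normrZ ger0_norm ?(ltW L20) // ler_pM2l //; apply: Wb.
    exact: (subspaceZ sW).
  rewrite normrZ ger0_norm ?invr_ge0 ?(ltW L20) // ler_pdivrMl //.
  exact: le_trans rhoL.
pose p := f (m + w) - c.
pose D := (1 + eta) * (L / 2 * (1 + r)) + Cf + eta * L.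
have e10 : 0 <= 1 + eta by lra.
have h1 : `|y' + p| <= D.
  rewrite (_ : y' + p = f (m + w) - f s); last by rewrite /p /c; lmodule R Y.
  have h : `|m + w - s| <= L / 2 * (1 + r).
    rewrite (_ : _ - s = (L / 2) *: z + w); first exact: scale.
    by rewrite /m /z; lmodule_field R X.
  have := fA (m + w) s; have e1 : (1 + eta) * `|m + w - s| <= (1 + eta) * (L / 2 * (1 + r)).
    by rewrite ler_wpM2l.
  have e2 : 0 <= eta * L by rewrite mulr_ge0 // ltW.
  by move: e1 e2; rewrite /D; lra.
have h2 : `|y' - p| <= D.
  rewrite (_ : y' - p = (f t - f (m + w)) - (f t - f s - L *: y)); last first.
    by rewrite /p /c /y'; lmodule_field R Y.
  have h : `|t - (m + w)| <= L / 2 * (1 + r).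
    rewrite (_ : t - _ = (L / 2) *: z + (- w)).
      by apply: scale; rewrite ?normrN //; apply: (subspaceN sW).
    by rewrite /m /z; lmodule_field R X.
  have := fA t (m + w); have : (1 + eta) * `|t - (m + w)| <= (1 + eta) * (L / 2 * (1 + r)).
    by rewrite ler_wpM2l.
  have := ler_normB (f t - f (m + w)) (f t - f s - L *: y).
  by rewrite /D; lra.
have h3 : `|p + (c - k) - u| <= E.
  by rewrite (_ : _ - u = f (m + w) - k - u) // /p; lmodule R Y.
have VNu : V (- u) by apply: (subspaceN sV).
have := two_sided_bound h1 h2 h3 (HV _ _ F1 Vu) (HV _ _ F2 VNu).
rewrite (_ : y' + _ = (L / 2) *: (y + (b / L) *: v)); last first.
  by rewrite /y' /u; lmodule_field R Y.
rewrite normrZ ger0_norm ?(ltW L20) // mulrC -ler_pdivlMr //.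
have -> // : (D + E) / (L / 2) = (1 + eta) * (1 + r) + 2 * (Cf + E) / L + 2 * eta.
by rewrite /D; field.
Qed.

Lemma le_rho_bar_at (R : realType) (Z : normedModType R) (z : Z) (t c : R) (V : set Z) :
  closed_finite_codim_subspace V ->
  (forall v, V v -> `|v| = 1 -> `|z + t *: v| - 1 <= c) ->
  (rho_bar_at z t <= c%:E)%E.
Proof.
move=> fV H; apply: le_trans (ereal_inf_lbound _) _; first by exists V.
by apply: ge_ereal_sup => _ [v [Vv v1] <-]; rewrite lee_fin H.
Qed.

Lemma rho_bar_lt (R : realType) (Z : normedModType R) (z : Z) (t r : R) :
  `|z| = 1 -> (rho_bar Z t < r%:E)%E ->
  exists2 W, closed_finite_codim_subspace W &
    forall w, W w -> `|w| = 1 -> `|z + t *: w| <= 1 + r.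
Proof.
move=> z1 rhor; have : (rho_bar_at z t < r%:E)%E.
  by apply: le_lt_trans rhor; apply: ereal_sup_ubound; exists z.
move=> /ereal_inf_lt[_ [W fW <-] Wr]; exists W => // w Ww w1.
have : ((`|z + t *: w| - 1)%:E <= r%:E)%E.
  by apply: le_trans (ltW Wr); apply: ereal_sup_ubound; exists w.
by rewrite lee_fin lerBlDl.
Qed.

Lemma lee_forall_gt (R : realType) (a b : \bar R) :
  (forall r : R, (b < r%:E)%E -> (a <= r%:E)%E) -> (a <= b)%E.
Proof.
move=> H; case: b H => [b||] H; [| exact: leey |].
  by apply/lee_addgt0Pr => e e0; rewrite -EFinD; apply: H; rewrite lte_fin ltrDl.
case: a H => [a||] H //.
  by have := H (a - 1) (ltNyr _); rewrite lee_fin => a1; exfalso; lra.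
by have := H 0 (ltNyr _).
Qed.

Theorem theorem7p1 (R : realType) (X Y : completeNormedModType R) (M : R)
  (hM : 1 < M) (f : X -> Y) (g : Y -> X)
  (hfc : continuous f) (hgc : continuous g)
  (hf : Lip_infty f = 1%E) (hg : (Lip_infty g < M%:E)%E)
  (hfg : exists C : R, [/\ 0 <= C,
           forall x : X, `|(g \o f) x - x| <= C
         & forall y : Y, `|(f \o g) y - y| <= C])
  (y : Y) (hy : unit_sphere Y y) (hatt : attains_norm f y) :
  forall t : R, 0 < t <= 1 ->
    (rho_bar_at y (t / (576 * M ^+ 3)) <= rho_bar X t)%E.
Proof.
move=> theta /andP[th0 _].
apply: lee_forall_gt => r Xr; apply/lee_addgt0Pr => eps eps0; rewrite -EFinD.
have [C [C0 gf fg]] := hfg.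
have [_ [s [t [st_neq st_oo st_dir]]]] := hatt.
have y1 : `|y| = 1 := hy.
have M0 : 0 < M by lra.
have M2 : 1 <= M ^+ 2 by rewrite exprn_ege1 // ltW.
have shrink : 0 <= (36 * M ^+ 2)^-1 <= 1.
  by apply/andP; split; [rewrite invr_ge0 | rewrite invf_le1]; lra.
(* eta * (r + 3) = eps / 2 for r >= 0, which absorbs every occurrence of eta in
   the bound of transfer_subspace. *)
pose eta := eps / (2 * (`|r| + 3)).
have r3 : 0 < `|r| + 3 by have := normr_ge0 r; lra.
have eta_small : 0 <= r -> eta * (r + 3) = eps / 2.
  by move=> r0; rewrite /eta ger0_norm //; field; lra.
have eta0 : 0 < eta by rewrite divr_gt0 // mulr_gt0.
have v0 : s 0%N - t 0%N != 0 by rewrite subr_eq0; apply/eqP.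
have Lf : (Lip_infty f < (1 + eta)%:E)%E by rewrite hf lte_fin ltrDl.
have [Cf Cf0 fA] := coarse_affine v0 Lf.
have y0 : y != 0 by rewrite -normr_eq0 y1 oner_neq0.
have [Cg Cg0 gB] := coarse_affine y0 hg.
have eta10 : 0 <= 1 + eta by lra.
have [E E0 HG] := gorelik_principle eta10 (ltW M0) Cf0 Cg0 C0 fA gB gf fg.
(* Distances beyond L0 make the additive constants negligible: the terms serve,
   in this order, for the bound on V, for the Gorelik principle, for staying in
   the ball of radius (L / 2) * theta, and for 2 * E < b. *)
pose L0 := 4 * (Cf + E) / eps + 16 * (Cg + C) / theta + 4 * E / theta
  + 32 * M * E / theta + 1.
have [n [Ln dirn]] : exists n, L0 <= `|s n - t n| /\
    `|y - `|s n - t n|^-1 *: (f (t n) - f (s n))| <= eta.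
  move: st_dir; rewrite hf /= scale1r => /cvgrPdist_le/(_ _ eta0) near_dir.
  move/cvgryPge: st_oo => /(_ L0) near_oo.
  by have [n [? ?]] := filter_ex (filterI near_oo near_dir); exists n.
set L := `|s n - t n| in Ln dirn.
have [T1 T2 T3 T4] : [/\ 0 <= 4 * (Cf + E) / eps, 0 <= 16 * (Cg + C) / theta,
    0 <= 4 * E / theta & 0 <= 32 * M * E / theta].
  have := ltW th0; have := ltW eps0; have := ltW M0 => ? ? ?.
  by split; apply: divr_ge0 => //; rewrite !mulr_ge0 // addr_ge0.
have L_gt0 : 0 < L by rewrite /L0 in Ln; lra.
have L1 : 4 * (Cf + E) <= L * eps by rewrite -ler_pdivrMr //; rewrite /L0 in Ln; lra.
have L2 : 16 * (Cg + C) <= L * theta by rewrite -ler_pdivrMr //; rewrite /L0 in Ln; lra.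
have L3 : 4 * E <= L * theta by rewrite -ler_pdivrMr //; rewrite /L0 in Ln; lra.
have L4 : 32 * M * E < L * theta by rewrite -ltr_pdivrMr //; rewrite /L0 in Ln; lra.
pose z := L^-1 *: (t n - s n).
have z1 : `|z| = 1.
  by rewrite normrZ distrC -/L ger0_norm ?invr_ge0 ?(ltW L_gt0) // mulVf // gt_eqF.
have [W [/submod_closedE sW _ fW] Wr] := rho_bar_lt z1 Xr.
pose delta := L * theta / 8; pose b := L * theta / (16 * M).
have b0 : 0 <= b by rewrite divr_ge0 // mulr_ge0 // ltW.
have Mb : M * b = L * theta / 16 by rewrite /b; field; rewrite gt_eqF.
have bdelta : M * b + Cg + C <= delta by rewrite Mb /delta; lra.
have [G HGu] := HG W (s n + 2^-1 *: (t n - s n)) delta b sW fW b0 bdelta.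
have dir : `|f (t n) - f (s n) - L *: y| <= eta * L.
  rewrite (_ : _ - L *: y = - (L *: (y - L^-1 *: (f (t n) - f (s n))))).
    by rewrite normrN normrZ ger0_norm ?(ltW L_gt0) // mulrC ler_wpM2r // ltW.
  have Ln0 : L != 0 by rewrite gt_eqF.
  by lmodule_field R Y.
have rhoL : 2 * delta + E <= L / 2 * theta by rewrite /delta; lra.
have Eb : 2 * E < b.
  by rewrite /b ltr_pdivlMr ?mulr_gt0 //; lra.
have [V fV HV] := transfer_subspace L_gt0 (erefl _) th0 (ltW eta0) fA dir sW Wr
  HGu rhoL E0 Eb.
apply: le_rho_bar_at fV _ => v Vv v1; have [r0 Hv] := HV v Vv v1.
have bound : `|y + (b / L) *: v| <= 1 + r + eps.
  apply: le_trans Hv _.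
  have e1 := eta_small r0.
  have e2 : 2 * (Cf + E) / L <= eps / 2 by rewrite ler_pdivrMr //; lra.
  by lra.
rewrite lerBlDl addrA.
(* Here b / L = theta / (16 * M), and 576 = 16 * 36. *)
rewrite (_ : theta / _ = (36 * M ^+ 2)^-1 * (b / L)); last first.
  by rewrite /b; field; rewrite !gt_eqF.
rewrite -scalerA; apply: norm_segment => //.
by rewrite y1 -addrA lerDl addr_ge0 // ltW.
Qed.
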